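(* Let $\alpha_1,\dots,\alpha_n$ be real numbers satisfying $\alpha_1\alpha_2\cdots\alpha_n=1$ and $\alpha_i>0$ for all $i=1,\dots,n$. Then $$\Theta_{\mathbb{Z}^n}^1(q)\leq \Theta_{\alpha_1 \mathbb{Z}\oplus \cdots \oplus \alpha_n \mathbb{Z}}^1(q)\quad\text{for all }0<q<1,$$ and the inequality is strict unless $\alpha_i=1$ for all $i=1,\dots,n$.
   Context: For a lattice $\Lambda\subseteq\mathbb{R}^n$, $\Theta^1_\Lambda(q)=\sum_{x\in\Lambda}q^{\|x\|_1}$ for real $0\le q<1$, where $\|x\|_1=\sum_i|x_i|$. The lattice $\alpha_1\mathbb{Z}\oplus\cdots\oplus\alpha_n\mathbb{Z}$ is $\{(\alpha_1k_1,\dots,\alpha_nk_n):k_i\in\mathbb{Z}\}\subseteq\mathbb{R}^n$. *)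

(* Defs.v *)
From HB Require Import structures.
From mathcomp Require Import all_boot all_order all_algebra.
From mathcomp Require Import all_classical all_reals all_analysis.
Set Implicit Arguments.
Unset Strict Implicit.
Unset Printing Implicit Defensive.
Import Order.TTheory GRing.Theory Num.Theory.

Local Open Scope classical_set_scope.
Local Open Scope ring_scope.

(* The library norm on row vectors is the sup norm, hence this definition. *)
Definition l1norm (R : realType) (n : nat) (x : 'rV[R]_n) : R :=
  \sum_(i < n) `|x 0 i|.

(* The series has nonnegative terms when 0 <= q, so its value is the supremum
   of the finite partial sums, taken in the extended reals; L may be any set.
   powR gives 0 `^ 0 = 1. *)
Definition theta1 (R : realType) (n : nat) (L : set 'rV[R]_n) (q : R)
    : \bar R :=
  \esum_(x in L) (q `^ l1norm x)%:E.

Definition int_lattice (R : realType) (n : nat) : set 'rV[R]_n :=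
  [set \row_(i < n) (k i)%:~R | k in [set: 'I_n -> int]].

Definition diag_lattice (R : realType) (n : nat) (alpha : 'I_n -> R)
    : set 'rV[R]_n :=
  [set \row_(i < n) (alpha i * (k i)%:~R) | k in [set: 'I_n -> int]].

(* Main.v *)
(* The theta series factors over the coordinates, and each factor is the
   geometric sum (1 + q^a) / (1 - q^a) = coth (a s / 2), where q = exp (-s).
   The function t |-> ln (coth (e^t / 2)) has derivative - e^t / sinh (e^t),
   which is strictly increasing because sinh x / x is; so the function lies
   strictly above its tangents. Summing the tangent inequality at t = ln s
   over the points t = ln (s a_i), the linear terms cancel because
   a_1 ... a_n = 1. *)
Require Import Defs.
From HB Require Import structures.
From mathcomp Require Import all_boot all_order all_algebra.
From mathcomp Require Import all_classical all_reals all_analysis.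
From mathcomp Require Import ring lra.
Set Implicit Arguments.
Unset Strict Implicit.
Import Order.TTheory GRing.Theory Num.Theory.
Import numFieldNormedType.Exports.
Local Open Scope ring_scope.

(** * Monotonicity of cosh x and of sinh x / x *)

Lemma expR_expRN_mono (R : realType) (c d : R) : 0 < c -> c < d ->
  expR c + expR (- c) < expR d + expR (- d).
Proof.
move=> c0 cd; rewrite !expRN.
have u1 : 1 < expR c by rewrite -expR0 ltr_expR.
have uv : expR c < expR d by rewrite ltr_expR.
move: (expR c) (expR d) u1 uv => u v u1 uv.
(* Over the common denominator [u * v], the difference of the two sides has numerator (v - u)(u v -
   1), positive because 1 < u < v. *)
have -> : u + u^-1 = (u * u * v + v) / (u * v) by field; lra.
have -> : v + v^-1 = (v * v * u + u) / (u * v) by field; lra.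
rewrite ltr_pM2r; last by rewrite invr_gt0 mulr_gt0; lra.
by have := mulr_gt0 (_ : 0 < v - u) (_ : 0 < u * v - 1); nra.
Qed.

Lemma is_derive_expR_subN (R : realType) (x : R) :
  is_derive x 1 (fun x => expR x - expR (- x)) (expR x + expR (- x)).
Proof.
apply: is_derive_eq.
by rewrite /GRing.scale/=; ring.
Qed.

Lemma MVT_is_derive (R : realType) (f df : R -> R) (a b : R) : a < b ->
  (forall x, a <= x -> is_derive x 1 f (df x)) ->
  exists2 c, a < c < b & f b - f a = df c * (b - a).
Proof.
move=> ab fdf; have [|| c] := @MVT R f df a b ab.
- by move=> x; rewrite in_itv/= => /andP[/ltW ax _]; exact: fdf.
- apply: derivable_within_continuous => x; rewrite in_itv/= => /andP[ax _].
  by have [] := fdf x ax.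
- by rewrite in_itv/=; exists c.
Qed.

(** The mean value theorem on [0, x] and [x, y] gives slopes 2 cosh c and 2 cosh d with c < x < d.
    The gap between the two sides is x (y - x) times the difference of these slopes. *)
Lemma expR_subN_slope_lt (R : realType) (x y : R) : 0 < x -> x < y ->
  y * (expR x - expR (- x)) < x * (expR y - expR (- y)).
Proof.
move=> x0 xy.
pose S (t : R) := expR t - expR (- t); pose C (t : R) := expR t + expR (- t).
have SE (t : R) : is_derive t 1 S (C t) by exact: is_derive_expR_subN.
have [d /andP[xd dy]] := MVT_is_derive xy (fun t _ => SE t).
have [c /andP[c0 cx]] := MVT_is_derive x0 (fun t _ => SE t).
rewrite /S/C oppr0 subrr !subr0 => Sc Sd.
have /expR_expRN_mono/(_ (lt_trans cx xd)) cd := c0.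
move: Sc Sd cd; move: (expR c + _) (expR d + _) (expR x - _) (expR y - _).
move=> C1 C2 Sx Sy -> Sd CC.
have -> : Sy = C1 * x + C2 * (y - x) by lra.
rewrite -subr_gt0 [ltRHS](_ : _ = x * (y - x) * (C2 - C1)); last by ring.
by rewrite !mulr_gt0// subr_gt0.
Qed.

(* The value at [2 * y] is [ln (coth y)]. *)
Definition lncoth_half (R : realType) (x : R) : R :=
  ln (1 + expR (- x)) - ln (1 - expR (- x)).

Lemma is_derive_lncoth_half (R : realType) (x : R) : 0 < x ->
  is_derive x 1 (@lncoth_half R) (- (2 / (expR x - expR (- x)))).
Proof.
move=> x0.
have e1 : expR (- x) < 1 by rewrite expR_lt1 oppr_lt0.
have e0 := expR_gt0 (- x).
have d1 : is_derive x 1 (fun x => ln (1 + expR (- x)))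
    ((1 + expR (- x))^-1 * - expR (- x)).
  apply: (@is_derive1_comp _ (@ln R) (fun x => 1 + expR (- x))).
    by apply: is_derive1_ln; lra.
  by apply: is_derive_eq; rewrite /GRing.scale/=; ring.
have d2 : is_derive x 1 (fun x => ln (1 - expR (- x)))
    ((1 - expR (- x))^-1 * expR (- x)).
  apply: (@is_derive1_comp _ (@ln R) (fun x => 1 - expR (- x))).
    by apply: is_derive1_ln; lra.
  by apply: is_derive_eq; rewrite /GRing.scale/=; ring.
apply: is_derive_eq.
(* With u = e^(-x) the claim is the rational identity -u/(1+u) - u/(1-u) = -2/(1/u - u). *)
have -> : expR x = (expR (- x))^-1 by rewrite expRN invrK.
move: (expR (- x)) e0 e1 => u u0 u1.
have uu : 0 < 1 - u * u by nra.
field; rewrite ?gt_eqF//; lra.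
Qed.

(** This is the tangent inequality in the variable ln x, of slope -s / sinh s at ln s. Equivalently,
    adding (s / sinh s) ln t to [lncoth_half t] gives a function [G] with a strict minimum at s. *)
Lemma lncoth_half_tangent (R : realType) (s x : R) : 0 < s -> 0 < x -> x != s ->
  lncoth_half s - 2 * s / (expR s - expR (- s)) * (ln x - ln s) < lncoth_half x.
Proof.
move=> s0 x0 xs; set K := (X in X * _).
pose G (t : R) := lncoth_half t + K * ln t.
pose dG (t : R) := - (2 / (expR t - expR (- t))) + K / t.
have dGE (t : R) : 0 < t -> is_derive t 1 G (dG t).
  move=> t0; have := is_derive_lncoth_half t0; have := is_derive1_ln t0 => ? ?.
  by apply: is_derive_eq; rewrite /dG/GRing.scale/= ?mulr0 ?addr0.
have S0 (t : R) : 0 < t -> 0 < expR t - expR (- t).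
  by move=> t0; rewrite subr_gt0 ltr_expR; lra.
(* The denominator is positive, so the sign of [dG t] is that of s sinh t - t sinh s: negative for t
   < s, positive for t > s. *)
have dGs (t : R) : 0 < t -> dG t =
  2 * (s * (expR t - expR (- t)) - t * (expR s - expR (- s))) /
    (t * (expR t - expR (- t)) * (expR s - expR (- s))).
  move=> t0; have := S0 _ t0; have := S0 _ s0; rewrite /dG /K.
  move: (expR t - _) (expR s - _) => St Ss h1 h2; field; lra.
suff : G s < G x by rewrite /G; lra.
have den (t : R) : 0 < t ->
    0 < (t * (expR t - expR (- t)) * (expR s - expR (- s)))^-1.
  by move=> t0; rewrite invr_gt0 !mulr_gt0// S0.
have /orP[xs'|xs'] : (x < s) || (s < x) by rewrite -neq_lt.
  have [|c /andP[xc cs] Gc] := @MVT_is_derive _ G dG _ _ xs'.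
    by move=> t xt; apply: dGE; lra.
  have c0 : 0 < c by lra.
  have := expR_subN_slope_lt c0 cs => h.
  have : dG c < 0 by rewrite dGs// nmulr_rlt0 ?den//; lra.
  by move=> h1; have : dG c * (s - x) < 0; [rewrite nmulr_rlt0; lra|lra].
have [|c /andP[sc cx] Gc] := @MVT_is_derive _ G dG _ _ xs'.
  by move=> t st; apply: dGE; lra.
have c0 : 0 < c by lra.
have := expR_subN_slope_lt s0 sc => h.
have : 0 < dG c by rewrite dGs// pmulr_rgt0 ?den//; lra.
by move=> h1; have : 0 < dG c * (x - s); [rewrite pmulr_rgt0; lra|lra].
Qed.

(** * Factorization of nonnegative sums over vectors *)

Lemma ge0_esumZl (R : realType) (T : choiceType) (A : set T) (c : R)
    (f : T -> \bar R) : 0 <= c -> (forall x, (0 <= f x)%E) ->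
  (\esum_(x in A) (c%:E * f x) = c%:E * \esum_(x in A) f x)%E.
Proof.
rewrite le_eqVlt => /predU1P[<- f0|].
  by rewrite mul0e; apply: esum1 => x _; rewrite mul0e.
have le_esumZl (d : R) (g : T -> \bar R) : 0 < d -> (forall x, (0 <= g x)%E) ->
    (\esum_(x in A) (d%:E * g x) <= d%:E * \esum_(x in A) g x)%E.
  move=> d0 g0; apply: ge_ereal_sup => _ [X XA <-].
  rewrite -ge0_mule_fsumr// lee_pmul2l ?lte_fin//.
  by apply: ereal_sup_ubound; exists X.
move=> c0 f0; apply/eqP; rewrite eq_le le_esumZl//=.
(* The reverse inequality is [le_esumZl] for the factor [c^-1] and the family c f. *)
rewrite -[leRHS]mul1e -(divff (lt0r_neq0 c0)) EFinM -muleA lee_pmul2l ?lte_fin//.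
under eq_esum => x _ do rewrite -[f x]mul1e -(mulVf (lt0r_neq0 c0)) EFinM -muleA.
by apply: le_esumZl; rewrite ?invr_gt0// => x; rewrite mule_ge0// lee_fin ltW.
Qed.

(** Induction on n: [e] splits off the first coordinate, and the sum over pairs becomes an iterated
    sum, as all terms are nonnegative. *)
Lemma esum_rV_prod (R : realType) (T : choiceType) (n : nat)
    (f : 'I_n -> T -> R) (c : 'I_n -> R) :
  (forall i x, 0 <= f i x) ->
  (forall i, \esum_(x in [set: T]) (f i x)%:E = (c i)%:E) ->
  \esum_(k in [set: 'rV[T]_n]) (\prod_(i < n) f i (k 0 i))%:E =
  (\prod_(i < n) c i)%:E.
Proof.
elim: n f c => [|n IHn] f c f0 fc.
  (* [T] may be empty, so the entries of the only vector of length 0 come from the empty index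
     type. *)
  have h (i : 'I_0) : T by case: i.
  rewrite big_ord0 (_ : [set: _]%classic = [set \row_i h i]%classic).
    by rewrite esum_set1 ?big_ord0 ?lee_fin.
  by apply/seteqP; split => // k _ /=; apply/rowP => -[].
pose e (p : T * 'rV[T]_n) : 'rV[T]_(1 + n) := row_mx (const_mx p.1) p.2.
have eE0 p : e p 0 ord0 = p.1.
  have -> : @ord0 n = lshift n (@ord0 0) by exact: val_inj.
  by rewrite row_mxEl mxE.
have eE1 p i : e p 0 (lift ord0 i) = p.2 0 i by rewrite -rshift1 row_mxEr.
have ebij : (set_bij ([set: T] `*`` (fun=> [set: 'rV[T]_n]))
    [set: 'rV[T]_n.+1] e)%classic.
  split => //.
    move=> [x k] [y l] _ _ /= exy; congr pair.
      by have := eE0 (x, k); rewrite exy eE0.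
    by apply/rowP => i; have := eE1 (x, k) i; rewrite exy eE1.
  move=> k _; exists (k 0 ord0, \row_i k 0 (lift ord0 i)) => //.
  apply/rowP => i; case: (unliftP ord0 i) => [j ->|->]; last exact: eE0.
  by rewrite eE1 mxE.
rewrite (@reindex_esum _ _ _ _ _ _ _ ebij).
rewrite -(esum_esum (a := fun x k => (\prod_(i < n.+1) f i (e (x, k) 0 i))%:E));
  last by move=> x k _ _; rewrite lee_fin prodr_ge0.
(* Needed to pull this constant out of the sum over the first coordinate. *)
have c0 : 0 <= \prod_(i < n) c (lift ord0 i).
  apply: prodr_ge0 => i _.
  by rewrite -lee_fin -fc esum_ge0// => x _; rewrite lee_fin.
rewrite big_ord_recl mulrC EFinM -fc -ge0_esumZl//; last first.
  by move=> x; rewrite lee_fin.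
apply: eq_esum => x _.
rewrite muleC -(IHn (fun i => f (lift ord0 i)))// -ge0_esumZl//; last first.
  by move=> k; rewrite lee_fin prodr_ge0.
apply: eq_esum => k _.
rewrite -EFinM big_ord_recl eE0; congr (_ * _)%:E.
by apply: eq_bigr => i _; rewrite eE1.
Qed.

(** * Closed forms of the theta series *)

Lemma esum_geometric (R : realType) (a r : R) : 0 <= a -> 0 <= r < 1 ->
  \esum_(i in [set: nat]) (a * r ^+ i)%:E = (a / (1 - r))%:E.
Proof.
move=> a0 /andP[r0 r1]; rewrite -nneseries_esumT; last first.
  by move=> i; rewrite lee_fin mulr_ge0// exprn_ge0.
have := @cvg_geometric_series R a r; rewrite ger0_norm// => /(_ r1) ar.
rewrite -(cvg_lim _ ar)// -EFin_lim; last by apply/cvg_ex; eexists; exact: ar.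
by apply: congr_lim; apply/funext => m /=; rewrite /series/= sumEFin.
Qed.

Lemma esum_expr_absz (R : realType) (r : R) : 0 <= r < 1 ->
  \esum_(k in [set: int]) (r ^+ `|k|)%:E = ((1 + r) / (1 - r))%:E.
Proof.
move=> r01; have /andP[r0 r1] := r01.
rewrite (esumID (range Posz)); last by move=> k _; rewrite lee_fin exprn_ge0.
rewrite !setTI (_ : (~` _)%classic = range Negz); last first.
  apply/seteqP; split=> [[k|k]/= kP|_ [k _ <-] []//].
    by exfalso; apply: kP; exists k.
  by exists k.
rewrite !esum_image; [|by move=> ? ? _ _ []..].
rewrite mulrDl EFinD -!esum_geometric//; congr (_ + _)%E; apply: eq_esum => k _.
  by rewrite mul1r.
(* [Negz k] is -(k + 1), so the negative half is a geometric series with first term r. *)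
by rewrite NegzE abszN absz_nat exprS.
Qed.

Lemma theta1_diag_lattice (R : realType) (n : nat) (alpha : 'I_n -> R) (q : R) :
  (forall i, 0 < alpha i) -> 0 < q < 1 ->
  theta1 (diag_lattice alpha) q =
  (\prod_(i < n) ((1 + q `^ alpha i) / (1 - q `^ alpha i)))%:E.
Proof.
move=> alpha0 /andP[q0 q1].
(* Integer row vectors replace functions as parameters, to fit [esum_rV_prod]; [e] is injective
   because each [alpha i] is nonzero. *)
pose e (k : 'rV[int]_n) : 'rV[R]_n := \row_i (alpha i * (k 0 i)%:~R).
have -> : diag_lattice alpha = range e.
  apply/seteqP; split => _ [k _ <-] /=.
    by exists (\row_i k i) => //; apply/rowP => i; rewrite !mxE.
  by exists (k 0).
rewrite /theta1 esum_image; last first.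
  move=> k l _ _ ekl; apply/rowP => i; have /rowP/(_ i) := ekl; rewrite !mxE.
  by move=> /(mulfI (lt0r_neq0 (alpha0 i)))/intr_inj.
rewrite -(@esum_rV_prod _ _ _ (fun i k => (q `^ alpha i) ^+ `|k|)).
- apply: eq_esum => k _; congr EFin.
  rewrite /powR gt_eqF// /l1norm mulr_suml expR_sum; apply: eq_bigr => i _.
  rewrite mxE normrM gtr0_norm// -expRM_natl; congr expR.
  by rewrite -intr_norm -abszE -pmulrn; ring.
- by move=> i x; rewrite exprn_ge0// powR_ge0.
- move=> i; apply: esum_expr_absz; rewrite powR_ge0/=.
  by rewrite /powR gt_eqF// expR_lt1 pmulr_rlt0// ln_lt0// q0.
Qed.

Lemma theta1_int_lattice (R : realType) (n : nat) (q : R) : 0 < q < 1 ->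
  theta1 (@int_lattice R n) q = (\prod_(i < n) ((1 + q) / (1 - q)))%:E.
Proof.
move=> q01; rewrite (_ : @int_lattice R n = diag_lattice (fun=> 1)).
  rewrite theta1_diag_lattice//; congr EFin; apply: eq_bigr => i _.
  by rewrite powRr1// ltW; case/andP: q01.
by congr image; apply/funext => k; apply/rowP => i; rewrite !mxE mul1r.
Qed.

(** * Comparison of the two products through their logarithms *)

Lemma expR_lncoth_half (R : realType) (x : R) : 0 < x ->
  expR (lncoth_half x) = (1 + expR (- x)) / (1 - expR (- x)).
Proof.
move=> x0; have e1 : expR (- x) < 1 by rewrite expR_lt1 oppr_lt0.
have e0 := expR_gt0 (- x).
by rewrite expRB !lnK// posrE; lra.
Qed.

Lemma sum_lncoth_half_leif (R : realType) (n : nat) (alpha : 'I_n -> R) (s : R) :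
  \prod_(i < n) alpha i = 1 -> (forall i, 0 < alpha i) -> 0 < s ->
  \sum_(i < n) lncoth_half s <= \sum_(i < n) lncoth_half (s * alpha i)
    ?= iff [forall i, alpha i == 1].
Proof.
move=> alpha1 alpha0 s0; pose K := 2 * s / (expR s - expR (- s)).
(* The added linear terms sum to -K times the sum of the ln(alpha_i), which is ln 1 = 0. Each
   summand is then the tangent at s evaluated at s alpha_i. *)
have -> : \sum_(i < n) lncoth_half s =
    \sum_(i < n) (lncoth_half s - K * (ln (s * alpha i) - ln s)).
  under [RHS]eq_bigr => i _ do rewrite lnM ?posrE// [ln s + _]addrC addrK.
  rewrite [RHS]sumrB -mulr_sumr (_ : \sum_(i < n) ln (alpha i) = 0) ?mulr0 ?subr0//.
  apply: expR_inj; rewrite expR_sum expR0 -[RHS]alpha1; apply: eq_bigr => i _.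
  by rewrite lnK ?posrE.
apply: leif_sum => i _; rewrite -/(alpha i == 1).
apply/leifP; case: (eqVneq (alpha i) 1) => [->|a1].
  by rewrite mulr1 subrr mulr0 subr0.
apply: lncoth_half_tangent; rewrite ?mulr_gt0//.
by apply: contra_neq a1 => /(canRL (mulKf (lt0r_neq0 s0))) ->; rewrite mulVf ?lt0r_neq0.
Qed.

Theorem proposition3 (R : realType) (n : nat) (alpha : 'I_n -> R)
    (prod_alpha : \prod_(i < n) alpha i = 1)
    (alpha_gt0 : forall i : 'I_n, 0 < alpha i) :
  (forall q : R, 0 < q < 1 ->
     (theta1 (@int_lattice R n) q <= theta1 (diag_lattice alpha) q)%E) /\
  (~ (forall i : 'I_n, alpha i = 1) ->
   forall q : R, 0 < q < 1 ->
     (theta1 (@int_lattice R n) q < theta1 (diag_lattice alpha) q)%E).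
Proof.
have int_le_diag (q : R) : 0 < q < 1 ->
    \prod_(i < n) ((1 + q) / (1 - q)) <=
    \prod_(i < n) ((1 + q `^ alpha i) / (1 - q `^ alpha i))
      ?= iff [forall i, alpha i == 1].
  (* With s = -ln q, the factor for alpha_i is the exponential of [lncoth_half] at s alpha_i. Since
     exp is strictly increasing, both the inequality and its equality case carry over from the
     sums. *)
  move=> /andP[q0 q1]; have s0 : 0 < - ln q by rewrite oppr_gt0 ln_lt0// q0.
  have -> : \prod_(i < n) ((1 + q) / (1 - q)) =
      expR (\sum_(i < n) lncoth_half (- ln q)).
    by rewrite expR_sum; apply: eq_bigr => i _; rewrite expR_lncoth_half// opprK lnK.
  have -> : \prod_(i < n) ((1 + q `^ alpha i) / (1 - q `^ alpha i)) =
      expR (\sum_(i < n) lncoth_half (- ln q * alpha i)).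
    rewrite expR_sum; apply: eq_bigr => i _; rewrite expR_lncoth_half ?mulr_gt0//.
    by rewrite mulNr opprK /powR gt_eqF// [alpha i * _]mulrC.
  have [le_sum eq_sum] := sum_lncoth_half_leif prod_alpha alpha_gt0 s0.
  by split; [rewrite ler_expR | rewrite (inj_eq (@expR_inj R))].
split=> [q q01|alpha_neq1 q q01];
  rewrite theta1_int_lattice// theta1_diag_lattice//; have [le eq] := int_le_diag q q01.
  by rewrite lee_fin.
rewrite lte_fin lt_neqAle le andbT eq; apply: contra_notN alpha_neq1.
by move=> /forallP alpha1 i; exact/eqP.
Qed.
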